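(* Let $0<\mu_x\le L_x$, $0<\mu_y\le L_y$, $L_{xy}\ge0$, and $f\in\mathcal F(\mu_x,\mu_y,L_x,L_y,L_{xy})$. For the step sizes $$\alpha=\frac12\min\left\{\frac1{L_x},\frac{\sqrt{\mu_y}}{L_{xy}\sqrt{L_x}}\right\},\qquad \beta=\frac12\min\left\{\frac1{L_y},\frac{\sqrt{\mu_x}}{L_{xy}\sqrt{L_y}}\right\},$$ Alt-GDA linearly converges with iteration complexity $$\mathcal O\left(\left(\kappa_x+\kappa_y+\kappa_{xy}(\sqrt{\kappa_x}+\sqrt{\kappa_y})\right)\cdot\log\frac{\Psi^{\mathrm{Alt}}_0}{A^{\mathrm{Alt}}\epsilon}\right),$$ where $A^{\mathrm{Alt}}=\min\left\{\frac1{2\alpha}-\mu_x,\ 2\left(\frac3{4\beta}-\mu_y\right)\right\}>0$.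
   Context: Function class. For $0<\mu_x\le L_x$, $0<\mu_y\le L_y$, $L_{xy}\ge0$, $\mathcal F(\mu_x,\mu_y,L_x,L_y,L_{xy})$ is the set of all twice-differentiable $f:\mathbb R^{d_x}\times\mathbb R^{d_y}\to\mathbb R$ such that: (i) $f(\cdot,y)$ is $\mu_x$-strongly convex for every $y$ and $f(x,\cdot)$ is $\mu_y$-strongly concave for every $x$ ($g$ is $\mu$-strongly convex if $g(z')\ge g(z)+\langle\nabla g(z),z'-z\rangle+\frac\mu2\|z'-z\|^2$ for all $z,z'$; $g$ is $\mu$-strongly concave if $-g$ is $\mu$-strongly convex); (ii) for all $x,x',y,y'$: $\|\nabla_xf(x',y)-\nabla_xf(x,y)\|\le L_x\|x'-x\|$, $\|\nabla_yf(x,y')-\nabla_yf(x,y)\|\le L_y\|y'-y\|$, $\|\nabla_xf(x,y')-\nabla_xf(x,y)\|\le L_{xy}\|y'-y\|$, $\|\nabla_yf(x',y)-\nabla_yf(x,y)\|\le L_{xy}\|x'-x\|$. Norms are Euclidean. Every such $f$ has a unique Nash equilibrium $z_\star=(x_\star,y_\star)$, i.e. a point with $f(x_\star,y)\le f(x_\star,y_\star)\le f(x,y_\star)$ for all $x,y$. Condition numbers: $\kappa_x=L_x/\mu_x$, $\kappa_y=L_y/\mu_y$, $\kappa_{xy}=L_{xy}/\sqrt{\mu_x\mu_y}$. Alt-GDA with constant step sizes $\alpha,\beta>0$: from any $(x_0,y_0)$, $x_{k+1}=x_k-\alpha\nabla_xf(x_k,y_k)$, $y_{k+1}=y_k+\beta\nabla_yf(x_{k+1},y_k)$;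 $z_k=(x_k,y_k)$. An iteration complexity upper bound is a number $K$ of iterations sufficient to ensure $\|z_K-z_\star\|^2\le\epsilon$. Lyapunov function: with $V^{\mathrm{Alt}}(x,y)=\left(\frac1\alpha-\mu_x\right)\|x-x_\star\|^2+\left(\frac1\beta-\mu_y\right)\|y-y_\star\|^2$, $$\Psi^{\mathrm{Alt}}_k=V^{\mathrm{Alt}}(x_k,y_k)+V^{\mathrm{Alt}}(x_{k+1},y_k)-\alpha(1-\alpha L_x)\|\nabla_xf(x_k,y_k)\|^2 .$$
   Formalization: The claim A>0 fails exactly when mu_x=L_x and L_xy<=sqrt(mu_y L_x) (then A=0, log undefined); it is replaced by this equivalence, and the complexity bound is stated for A>0, linear convergence always. For L_xy=0 the second term in each min is read as infinity. *)

(* Defs.v *)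
From HB Require Import structures.
From mathcomp Require Import all_boot all_order all_algebra.
From mathcomp Require Import all_classical all_reals all_analysis.
Set Implicit Arguments.
Unset Strict Implicit.
Unset Printing Implicit Defensive.
Import Order.TTheory GRing.Theory Num.Theory.
Import numFieldNormedType.Exports.
Local Open Scope ring_scope.

(* The library norm `|u| on 'rV[R]_n is the sup norm: it is used only through
   the topology (derivatives), while every norm of the statement is [enorm]. *)
Definition dot (R : realType) (n : nat) (u v : 'rV[R]_n) : R :=
  \sum_(i < n) u 0 i * v 0 i.

Definition enorm (R : realType) (n : nat) (u : 'rV[R]_n) : R :=
  Num.sqrt (dot u u).

(* Squared Euclidean distance on the product R^dx x R^dy. *)
Definition sqdist (R : realType) (dx dy : nat)
    (z w : 'rV[R]_dx * 'rV[R]_dy) : R :=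
  enorm (z.1 - w.1) ^+ 2 + enorm (z.2 - w.2) ^+ 2.

Definition grad (R : realType) (n : nat) (g : 'rV[R]_n -> R) (u : 'rV[R]_n) :
    'rV[R]_n :=
  \row_(i < n) 'D_(delta_mx 0 i) g u.

Definition grad_x (R : realType) (dx dy : nat)
    (f : 'rV[R]_dx * 'rV[R]_dy -> R) (z : 'rV[R]_dx * 'rV[R]_dy) : 'rV[R]_dx :=
  grad (fun x => f (x, z.2)) z.1.

Definition grad_y (R : realType) (dx dy : nat)
    (f : 'rV[R]_dx * 'rV[R]_dy -> R) (z : 'rV[R]_dx * 'rV[R]_dy) : 'rV[R]_dy :=
  grad (fun y => f (z.1, y)) z.2.

(* Frechet differentiability of f and of its gradient map. *)
Definition twice_differentiable (R : realType) (dx dy : nat)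
    (f : 'rV[R]_dx * 'rV[R]_dy -> R) : Prop :=
  forall z, [/\ differentiable f z,
                differentiable (grad_x f) z & differentiable (grad_y f) z].

Definition strongly_convex (R : realType) (n : nat) (mu : R)
    (g : 'rV[R]_n -> R) : Prop :=
  forall u v, g u + dot (grad g u) (v - u) + mu / 2 * enorm (v - u) ^+ 2 <= g v.

Definition strongly_concave (R : realType) (n : nat) (mu : R)
    (g : 'rV[R]_n -> R) : Prop :=
  strongly_convex mu (fun u => - g u).

Record function_class (R : realType) (dx dy : nat) (mux muy Lx Ly Lxy : R)
    (f : 'rV[R]_dx * 'rV[R]_dy -> R) : Prop := FunctionClass {
  fc_diff2 : twice_differentiable f ;
  fc_convex : forall y, strongly_convex mux (fun x => f (x, y)) ;
  fc_concave : forall x, strongly_concave muy (fun y => f (x, y)) ;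
  fc_lip_xx : forall x x' y,
    enorm (grad_x f (x', y) - grad_x f (x, y)) <= Lx * enorm (x' - x) ;
  fc_lip_yy : forall x y y',
    enorm (grad_y f (x, y') - grad_y f (x, y)) <= Ly * enorm (y' - y) ;
  fc_lip_xy : forall x y y',
    enorm (grad_x f (x, y') - grad_x f (x, y)) <= Lxy * enorm (y' - y) ;
  fc_lip_yx : forall x x' y,
    enorm (grad_y f (x', y) - grad_y f (x, y)) <= Lxy * enorm (x' - x) }.

Definition nash_equilibrium (R : realType) (dx dy : nat)
    (f : 'rV[R]_dx * 'rV[R]_dy -> R) (zs : 'rV[R]_dx * 'rV[R]_dy) : Prop :=
  forall x y, f (zs.1, y) <= f zs /\ f zs <= f (x, zs.2).

Definition altgda_x (R : realType) (dx dy : nat)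
    (f : 'rV[R]_dx * 'rV[R]_dy -> R) (alpha : R)
    (z : 'rV[R]_dx * 'rV[R]_dy) : 'rV[R]_dx :=
  z.1 - alpha *: grad_x f z.

Definition altgda_step (R : realType) (dx dy : nat)
    (f : 'rV[R]_dx * 'rV[R]_dy -> R) (alpha beta : R)
    (z : 'rV[R]_dx * 'rV[R]_dy) : 'rV[R]_dx * 'rV[R]_dy :=
  let x' := altgda_x f alpha z in (x', z.2 + beta *: grad_y f (x', z.2)).

Definition altgda (R : realType) (dx dy : nat)
    (f : 'rV[R]_dx * 'rV[R]_dy -> R) (alpha beta : R)
    (z0 : 'rV[R]_dx * 'rV[R]_dy) (k : nat) : 'rV[R]_dx * 'rV[R]_dy :=
  iter k (altgda_step f alpha beta) z0.

(* min {1 / L, sqrt mu / (Lxy * sqrt L)} / 2, where the second term is +oo when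
   Lxy = 0 (division by 0 yields 0 in the library).  The step size alpha is
   [step_size Lx muy Lxy] and beta is [step_size Ly mux Lxy]. *)
Definition step_size (R : realType) (L mu Lxy : R) : R :=
  2^-1 * (if Lxy == 0 then 1 / L
          else Num.min (1 / L) (Num.sqrt mu / (Lxy * Num.sqrt L))).

Definition V_alt (R : realType) (dx dy : nat) (mux muy alpha beta : R)
    (zs z : 'rV[R]_dx * 'rV[R]_dy) : R :=
  (1 / alpha - mux) * enorm (z.1 - zs.1) ^+ 2
  + (1 / beta - muy) * enorm (z.2 - zs.2) ^+ 2.

Definition Psi_alt (R : realType) (dx dy : nat) (mux muy Lx : R)
    (f : 'rV[R]_dx * 'rV[R]_dy -> R) (alpha beta : R)
    (zs z0 : 'rV[R]_dx * 'rV[R]_dy) (k : nat) : R :=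
  let z := altgda f alpha beta z0 in
  V_alt mux muy alpha beta zs ((z k).1, (z k).2)
  + V_alt mux muy alpha beta zs ((z k.+1).1, (z k).2)
  - alpha * (1 - alpha * Lx) * enorm (grad_x f (z k)) ^+ 2.

Definition A_alt (R : realType) (mux muy alpha beta : R) : R :=
  Num.min (1 / (2 * alpha) - mux) (2 * (3 / (4 * beta) - muy)).

Definition linearly_converges (R : realType) (dx dy : nat)
    (z : nat -> 'rV[R]_dx * 'rV[R]_dy) (zs : 'rV[R]_dx * 'rV[R]_dy) : Prop :=
  exists M rho : R, 0 <= rho < 1 /\ forall k, sqdist (z k) zs <= M * rho ^+ k.

(* Main.v *)
Require Import Defs.
From HB Require Import structures.
From mathcomp Require Import all_boot all_order all_algebra.
From mathcomp Require Import all_classical all_reals all_analysis.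
From mathcomp Require Import ring lra.
Import Order.TTheory GRing.Theory Num.Theory.
Import numFieldNormedType.Exports.
Local Open Scope ring_scope.

(* One gradient step on a mu-strongly convex, L-smooth phi satisfies a three-point
   inequality towards the minimiser in two forms, with phi evaluated before or
   after the step.  Summing the form "after" for x at (x_k, y_k), both forms for y
   at (x_{k+1}, y_k), and the form "before" for x at (x_{k+1}, y_{k+1}), the values
   of f combine into duality gaps and all but a^2 Lx |grad_x f(z_{k+1})|^2 and
   b^2 Ly |grad_y f(x_{k+1}, y_k)|^2 telescopes into Psi.  Comparing these gradients
   with those at y = y* and x = x*, the gaps (via |grad phi|^2 <= 2 L (phi - min phi))
   and the strong convexity terms absorb them: this is exactly what the step sizes
   allow.  Hence (1 + theta) Psi_{k+1} <= Psi_k with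
   theta = min (alpha mux, beta muy) / 2. *)

(** * Euclidean inner product and norm *)

Lemma dotC {R : realType} {n : nat} (u v : 'rV[R]_n) : dot u v = dot v u.
Proof. by apply: eq_bigr => i _; rewrite mulrC. Qed.

Lemma dotDl {R : realType} {n : nat} (u v w : 'rV[R]_n) :
  dot (u + v) w = dot u w + dot v w.
Proof. by rewrite -big_split; apply: eq_bigr => i _; rewrite mxE mulrDl. Qed.

Lemma dotZl {R : realType} {n : nat} (a : R) (u v : 'rV[R]_n) :
  dot (a *: u) v = a * dot u v.
Proof. by rewrite mulr_sumr; apply: eq_bigr => i _; rewrite mxE mulrA. Qed.

Lemma dotNl {R : realType} {n : nat} (u v : 'rV[R]_n) : dot (- u) v = - dot u v.
Proof. by rewrite -scaleN1r dotZl mulN1r. Qed.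

Lemma dotDr {R : realType} {n : nat} (u v w : 'rV[R]_n) :
  dot w (u + v) = dot w u + dot w v.
Proof. by rewrite !(dotC w) dotDl. Qed.

Lemma dotZr {R : realType} {n : nat} (a : R) (u v : 'rV[R]_n) :
  dot u (a *: v) = a * dot u v.
Proof. by rewrite !(dotC u) dotZl. Qed.

Lemma dotNr {R : realType} {n : nat} (u v : 'rV[R]_n) : dot u (- v) = - dot u v.
Proof. by rewrite !(dotC u) dotNl. Qed.

Definition dotE := (@dotDl, @dotDr, @dotZl, @dotZr, @dotNl, @dotNr).

Lemma dot_ge0 {R : realType} {n : nat} (u : 'rV[R]_n) : 0 <= dot u u.
Proof. by apply: sumr_ge0 => i _; rewrite -expr2 sqr_ge0. Qed.

Lemma dot_le0 {R : realType} {n : nat} (u : 'rV[R]_n) : dot u u <= 0 -> u = 0.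
Proof.
move=> u0; apply/rowP => i; rewrite mxE; apply/eqP; rewrite -sqrf_eq0.
rewrite eq_le sqr_ge0 andbT; apply: le_trans u0.
rewrite /dot (bigD1 i)//= -expr2 lerDl.
by apply: sumr_ge0 => j _; rewrite -expr2 sqr_ge0.
Qed.

Lemma enorm_ge0 {R : realType} {n : nat} (u : 'rV[R]_n) : 0 <= enorm u.
Proof. exact: sqrtr_ge0. Qed.

Lemma enorm_sqr {R : realType} {n : nat} (u : 'rV[R]_n) : enorm u ^+ 2 = dot u u.
Proof. by rewrite sqr_sqrtr// dot_ge0. Qed.

Lemma dot_sqrD_le {R : realType} {n : nat} (u v : 'rV[R]_n) :
  dot (u + v) (u + v) <= 2 * dot u u + 2 * dot v v.
Proof. by have := dot_ge0 (u - v); rewrite !dotE (dotC v u); lra. Qed.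

Lemma enorm_le_dot {R : realType} {m n : nat} {L : R} {u : 'rV[R]_m} {v : 'rV[R]_n} :
  enorm u <= L * enorm v -> dot u u <= L ^+ 2 * dot v v.
Proof.
move=> uv; rewrite -!enorm_sqr -exprMn ler_pXn2r ?nnegrE ?enorm_ge0//.
exact: le_trans (enorm_ge0 u) uv.
Qed.

(** Splits [u] as [w + (u - w)]. The two dimensions differ because a cross Lipschitz bound measures
    a gradient in x by a displacement in y, and conversely. *)
Lemma dot_le_nearby {R : realType} {m n : nat} {L : R} {u w : 'rV[R]_m}
    {v : 'rV[R]_n} :
  enorm (u - w) <= L * enorm v ->
  dot u u <= 2 * dot w w + 2 * (L ^+ 2 * dot v v).
Proof.
move=> /enorm_le_dot uw; have := dot_sqrD_le w (u - w).
by rewrite [w + _]addrC subrK => /le_trans; apply; rewrite lerD2l ler_pM2l.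
Qed.

(** * Smooth strongly convex functions and one gradient step *)

Lemma le_geometric_error {R : realType} (x y B : R) : 0 <= B ->
  (forall n, x <= y + 2^-1 ^+ n * B) -> x <= y.
Proof.
move=> B0 xy; apply/ler_addgt0Pr => e e0.
have [n nB] : exists n : nat, B / e < n%:R.
  by exists (Num.bound (B / e)); rewrite archi_boundP// divr_ge0// ltW.
apply: le_trans (xy n) _; rewrite lerD2l exprVn ler_pdivrMl ?exprn_gt0//.
move: nB; rewrite ltr_pdivrMr// => /ltW nB; apply: le_trans nB _.
by rewrite ler_pM2r// -natrX ler_nat ltnW// ltn_expl.
Qed.

(* [G] stands for the gradient of [phi]; only these two inequalities are used. *)
Definition smooth_strongly_convex {R : realType} {n : nat} (mu L : R)
    (phi : 'rV[R]_n -> R) (G : 'rV[R]_n -> 'rV[R]_n) : Prop :=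
  (forall u v, phi u + dot (G u) (v - u) + mu / 2 * dot (v - u) (v - u) <= phi v) /\
  (forall u v, dot (G v - G u) (G v - G u) <= L ^+ 2 * dot (v - u) (v - u)).

(* The constant [L] is immediate from convexity; splitting a segment at its
   midpoint maps an admissible constant [c] to [c / 2 + L / 4], whose iterates
   tend to [L / 2]. *)
Lemma descent {R : realType} {n : nat} {mu L : R} {phi : 'rV[R]_n -> R}
    {G : 'rV[R]_n -> 'rV[R]_n} (u v : 'rV[R]_n) :
  0 <= mu -> 0 < L -> smooth_strongly_convex mu L phi G ->
  phi v <= phi u + dot (G u) (v - u) + L / 2 * dot (v - u) (v - u).
Proof.
move=> mu0 L0 [cvx lip].
(* Nonnegativity of |a - L b|^2 together with |a| <= L |b| replaces Cauchy-Schwarz. *)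
have mono (x y : 'rV[R]_n) : dot (G y - G x) (y - x) <= L * dot (y - x) (y - x).
  have := dot_ge0 (G y - G x - L *: (y - x)); have := lip x y.
  move: (G y - G x) (y - x) => a b; rewrite !dotE (dotC b a) => ab ab0.
  by rewrite -(ler_pM2l L0); nra.
(* The constants (1 + 2^-k) L / 2 are the iterates of c -> c / 2 + L / 4 started at c = L. *)
have approx k x y : phi y <= phi x + dot (G x) (y - x)
    + (1 + 2^-1 ^+ k) * (L / 2) * dot (y - x) (y - x).
  elim: k x y => [|k IH] x y.
    have := cvx y x; have := mono x y; have := mulr_ge0 mu0 (dot_ge0 (x - y)).
    by rewrite !dotE (dotC y x) expr0; lra.
  pose d := 2^-1 *: (y - x); pose m := x + d.
  have yx : y - x = 2 *: d by rewrite scalerA divff ?scale1r// pnatr_eq0.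
  have mx : m - x = d by rewrite /m addrC addKr.
  have ym : y - m = d.
    by rewrite /m opprD addrA yx scaler_nat mulr2n addrK.
  have := IH x m; have := IH m y; have := mono x m.
  rewrite mx ym yx !dotE exprS; set p := _ ^+ k; set q := dot d d.
  by move=> h1 h2 h3; lra.
apply: (@le_geometric_error _ _ _ (L / 2 * dot (v - u) (v - u))).
  by rewrite mulr_ge0 ?dot_ge0// divr_ge0// ltW.
by move=> k; have := approx k u v; lra.
Qed.

(** A step of length 1 / L lowers [phi] by at least |G u|^2 / (2 L), and it cannot go below the
    minimum. *)
Lemma grad_sqr_le_gap {R : realType} {n : nat} {mu L : R} {phi : 'rV[R]_n -> R}
    {G : 'rV[R]_n -> 'rV[R]_n} (u w : 'rV[R]_n) :
  0 <= mu -> 0 < L -> smooth_strongly_convex mu L phi G ->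
  (forall v, phi w <= phi v) ->
  dot (G u) (G u) <= 2 * L * (phi u - phi w).
Proof.
move=> mu0 L0 sc wmin.
have := le_trans (wmin _) (descent u (u - L^-1 *: G u) mu0 L0 sc).
rewrite [u - _ - u]addrAC subrr add0r !dotE => h.
have -> : dot (G u) (G u) = 2 * L * (L^-1 * dot (G u) (G u) / 2).
  by field; rewrite gt_eqF.
rewrite ler_pM2l; last by lra.
suff : L / 2 * - - (L^-1 * (L^-1 * dot (G u) (G u))) = L^-1 * dot (G u) (G u) / 2.
  by rewrite -?mulNr in h *; lra.
by field; rewrite gt_eqF.
Qed.

(** The form before the step: expanding the square leaves -2 <G u, u - w>, which strong convexity at
    [u] bounds. *)
Lemma grad_step_le {R : realType} {n : nat} {mu L a : R} {phi : 'rV[R]_n -> R}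
    {G : 'rV[R]_n -> 'rV[R]_n} (u w : 'rV[R]_n) :
  0 < a -> smooth_strongly_convex mu L phi G ->
  a^-1 * dot (u - a *: G u - w) (u - a *: G u - w) - a * dot (G u) (G u)
    + 2 * (phi u - phi w) <= (a^-1 - mu) * dot (u - w) (u - w).
Proof.
move=> a0 [cvx _]; have := cvx u w.
rewrite [u - _ - w]addrAC -[w - u]opprB; move: (u - w) => d.
rewrite !dotE (dotC d (G u)).
move: (dot (G u) (G u)) (dot (G u) d) (dot d d) (phi u) (phi w) => gg gd dd p q h.
suff : a^-1 * (dd + - (a * gd) + (- (a * gd) - - (a * (a * gg))))
    = a^-1 * dd - 2 * gd + a * gg.
  by move=> e; lra.
by field; rewrite gt_eqF.
Qed.

(** The form after the step: by [descent], 2 phi(u) is at least 2 phi(u - a G u) + a (2 - a L) |G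
    u|^2, so the coefficient -a of |G u|^2 becomes a (1 - a L). *)
Lemma grad_step_descent_le {R : realType} {n : nat} {mu L a : R}
    {phi : 'rV[R]_n -> R} {G : 'rV[R]_n -> 'rV[R]_n} (u w : 'rV[R]_n) :
  0 < a -> 0 <= mu -> 0 < L -> smooth_strongly_convex mu L phi G ->
  a^-1 * dot (u - a *: G u - w) (u - a *: G u - w)
    + a * (1 - a * L) * dot (G u) (G u) + 2 * (phi (u - a *: G u) - phi w)
    <= (a^-1 - mu) * dot (u - w) (u - w).
Proof.
move=> a0 mu0 L0 sc; have := grad_step_le u w a0 sc.
have := descent u (u - a *: G u) mu0 L0 sc.
rewrite [u - _ - u]addrAC subrr add0r !dotE.
by move: (dot (G u) (G u)) (phi (u - _)) => *; lra.
Qed.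

(** * Slices of a function of the class *)

Lemma gradN {R : realType} {n : nat} (g : 'rV[R]_n -> R) (u : 'rV[R]_n) :
  differentiable g u -> grad (fun v => - g v) u = - grad g u.
Proof.
move=> dg; apply/rowP => i; rewrite !mxE.
by rewrite -deriveN//; exact: diff_derivable.
Qed.

Lemma function_class_x {R : realType} {dx dy : nat} {mux muy Lx Ly Lxy : R}
    {f : 'rV[R]_dx * 'rV[R]_dy -> R} (y : 'rV[R]_dy) :
  function_class mux muy Lx Ly Lxy f ->
  smooth_strongly_convex mux Lx (fun x => f (x, y)) (fun x => grad_x f (x, y)).
Proof.
move=> fc; split => u v; first by rewrite -enorm_sqr; exact: (fc_convex fc).
exact: enorm_le_dot (fc_lip_xx fc u v y).
Qed.

(** Strong concavity is phrased with the gradient of the negated slice; differentiability of the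
    slice identifies it with [- grad_y f]. *)
Lemma function_class_y {R : realType} {dx dy : nat} {mux muy Lx Ly Lxy : R}
    {f : 'rV[R]_dx * 'rV[R]_dy -> R} (x : 'rV[R]_dx) :
  function_class mux muy Lx Ly Lxy f ->
  smooth_strongly_convex muy Ly (fun y => - f (x, y)) (fun y => - grad_y f (x, y)).
Proof.
move=> fc; split => u v.
  have dfx : differentiable (fun y => f (x, y)) u.
    apply: (@differentiable_comp _ _ _ _ (fun y => (x, y)) f).
      by apply: differentiable_pair; [exact: differentiable_cst|exact: ex_diff].
    by have [] := fc_diff2 fc (x, u).
  rewrite -enorm_sqr -[grad_y f (x, u)]/(grad (fun y => f (x, y)) u) -gradN//.
  exact: (fc_concave fc).
rewrite -opprD dotNl dotNr opprK; exact: enorm_le_dot (fc_lip_yy fc x u v).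
Qed.

(** * Dissipation of the Lyapunov function along the iteration *)

(** In the sum of the four step inequalities the values of [f] reduce to 2 (2 f(x1, ys) - f(xs, y) -
    f(xs, y1)), a sum of duality gaps. The losses mux / 2 |x1 - xs|^2 and muy / 2 |y1 - ys|^2 on the
    left pay for the cross Lipschitz errors. *)
Lemma altgda_one_step {R : realType} {dx dy : nat} {mux muy Lx Ly Lxy a b : R}
    {f : 'rV[R]_dx * 'rV[R]_dy -> R} {xs : 'rV[R]_dx} {ys : 'rV[R]_dy}
    (x x1 x2 : 'rV[R]_dx) (y y1 : 'rV[R]_dy) :
  0 <= mux -> 0 <= muy -> 0 < Lx -> 0 < Ly -> 0 < a -> 0 < b ->
  2 * a * Lx <= 1 -> 2 * b * Ly <= 1 ->
  4 * a ^+ 2 * Lx * Lxy ^+ 2 <= muy -> 4 * b ^+ 2 * Ly * Lxy ^+ 2 <= mux ->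
  function_class mux muy Lx Ly Lxy f -> nash_equilibrium f (xs, ys) ->
  x1 = x - a *: grad_x f (x, y) ->
  y1 = y + b *: grad_y f (x1, y) ->
  x2 = x1 - a *: grad_x f (x1, y1) ->
  (a^-1 - mux / 2) * dot (x1 - xs) (x1 - xs) + a^-1 * dot (x2 - xs) (x2 - xs)
    + 2 * (b^-1 - muy / 4) * dot (y1 - ys) (y1 - ys)
    - a * (1 - a * Lx) * dot (grad_x f (x1, y1)) (grad_x f (x1, y1))
  <= (a^-1 - mux) * (dot (x - xs) (x - xs) + dot (x1 - xs) (x1 - xs))
    + 2 * (b^-1 - muy) * dot (y - ys) (y - ys)
    - a * (1 - a * Lx) * dot (grad_x f (x, y)) (grad_x f (x, y)).
Proof.
move=> mux0 muy0 Lx0 Ly0 a0 b0 aLx bLy aLxy bLxy fc nash.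
move gE : (grad_x f (x, y)) => g; move hE : (grad_y f (x1, y)) => h.
move g1E : (grad_x f (x1, y1)) => g1 x1E y1E x2E.
have := grad_step_descent_le x xs a0 mux0 Lx0 (function_class_x y fc).
rewrite /= gE -x1E => x_at_y.
have := grad_step_le x1 xs a0 (function_class_x y1 fc).
rewrite /= g1E -x2E => x_at_y1.
have := grad_step_le y ys b0 (function_class_y x1 fc).
rewrite /= scalerN opprK dotNl dotNr opprK hE -y1E => y_at_x1.
have := grad_step_descent_le y ys b0 muy0 Ly0 (function_class_y x1 fc).
rewrite /= scalerN opprK dotNl dotNr opprK hE -y1E => y_at_x1'.
have xmin (v : 'rV[R]_dx) : f (xs, ys) <= f (v, ys) by have [] := nash v ys.
have ymin (v : 'rV[R]_dy) : - f (xs, ys) <= - f (xs, v).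
  by rewrite lerN2; have [] := nash xs v.
(* [g1] is compared with the gradient at y = ys and [h] with the one at x = xs: in these slices the
   equilibrium is extremal, so [grad_sqr_le_gap] applies. *)
have g1_le := dot_le_nearby (fc_lip_xy fc x1 ys y1).
have h_le := dot_le_nearby (fc_lip_yx fc xs x1 y).
rewrite g1E in g1_le; rewrite hE in h_le.
have := grad_sqr_le_gap x1 xs mux0 Lx0 (function_class_x ys fc) xmin.
move: g1_le; rewrite /=; move: (grad_x f (x1, ys)) => gs g1_le gs_le.
have := grad_sqr_le_gap y ys muy0 Ly0 (function_class_y xs fc) ymin.
move: h_le; rewrite /= dotNl dotNr opprK.
move: (grad_y f (xs, y)) => hs h_le hs_le.
have {}aLxy := ler_wpM2r (dot_ge0 (y1 - ys)) aLxy.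
have {}bLxy := ler_wpM2r (dot_ge0 (x1 - xs)) bLxy.
have a2L : 0 <= a ^+ 2 * Lx by rewrite mulr_ge0 ?sqr_ge0// ltW.
have b2L : 0 <= b ^+ 2 * Ly by rewrite mulr_ge0 ?sqr_ge0// ltW.
have aLx2 : 4 * (a * Lx) ^+ 2 <= 1.
  have -> : 4 * (a * Lx) ^+ 2 = (2 * a * Lx) ^+ 2 by ring.
  by rewrite exprn_ile1// !mulr_ge0// ltW.
have bLy2 : 4 * (b * Ly) ^+ 2 <= 1.
  have -> : 4 * (b * Ly) ^+ 2 = (2 * b * Ly) ^+ 2 by ring.
  by rewrite exprn_ile1// !mulr_ge0// ltW.
have {}g1_le := ler_wpM2l a2L g1_le; have {}h_le := ler_wpM2l b2L h_le.
have {}gs_le := ler_wpM2l a2L gs_le; have {}hs_le := ler_wpM2l b2L hs_le.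
have x1s := xmin x1; have y1s := ymin y1; have y0s := ymin y.
(* The gradient [gs] contributes 2 a^2 Lx |gs|^2 <= 4 (a Lx)^2 gap, so 2 a Lx <= 1 lets a single gap
   absorb it. *)
have gapx : 4 * (a * Lx) ^+ 2 * (f (x1, ys) - f (xs, ys)) <= f (x1, ys) - f (xs, ys).
  by rewrite ler_piMl// subr_ge0.
have gapy : 4 * (b * Ly) ^+ 2 * (f (xs, ys) - f (xs, y)) <= f (xs, ys) - f (xs, y).
  by rewrite ler_piMl// subr_ge0 -lerN2.
move: (dot g g) (dot h h) (dot g1 g1) (dot gs gs) (dot hs hs) (dot (x - xs) _)
  (dot (x1 - xs) _) (dot (x2 - xs) _) (dot (y - ys) _) (dot (y1 - ys) _)
  (f (x1, y)) (f (xs, y)) (f (x1, ys)) (f (xs, ys)) (f (x1, y1)) (f (xs, y1))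
  x_at_y x_at_y1 y_at_x1 y_at_x1' g1_le h_le gs_le hs_le aLxy bLxy gapx gapy
  x1s y1s y0s.
clear; move: a^-1 b^-1 => ia ib *; lra.
Qed.

(** The extra terms are differences between the coefficients of [altgda_one_step] and of [Psi_alt],
    such as 2 (1/b - muy/4) - 2 (1/b - muy) = 3/2 muy. For positive moduli they control the distance
    to [zs] even when [A_alt] vanishes. *)
Lemma altgda_dissipation {R : realType} {dx dy : nat} {mux muy Lx Ly Lxy a b : R}
    {f : 'rV[R]_dx * 'rV[R]_dy -> R} {zs : 'rV[R]_dx * 'rV[R]_dy}
    (z0 : 'rV[R]_dx * 'rV[R]_dy) (k : nat)
    (z := altgda f a b z0) (Psi := Psi_alt mux muy Lx f a b zs z0) :
  0 <= mux -> 0 <= muy -> 0 < Lx -> 0 < Ly -> 0 < a -> 0 < b ->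
  2 * a * Lx <= 1 -> 2 * b * Ly <= 1 ->
  4 * a ^+ 2 * Lx * Lxy ^+ 2 <= muy -> 4 * b ^+ 2 * Ly * Lxy ^+ 2 <= mux ->
  function_class mux muy Lx Ly Lxy f -> nash_equilibrium f zs ->
  Psi k.+1 + mux / 2 * enorm ((z k.+1).1 - zs.1) ^+ 2
    + mux * enorm ((z k.+2).1 - zs.1) ^+ 2
    + 3 / 2 * muy * enorm ((z k.+1).2 - zs.2) ^+ 2 <= Psi k.
Proof.
move=> mux0 muy0 Lx0 Ly0 a0 b0 aLx bLy aLxy bLxy fc nash.
rewrite {}/Psi /Psi_alt /V_alt -/z.
have zS i : z i.+1 = altgda_step f a b (z i) by [].
rewrite !zS; case: (z k) => x y; case: zs nash => xs ys nash.
move s1E : (altgda_step f a b (x, y)) => [x1 y1].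
move s2E : (altgda_step f a b (x1, y1)) => [x2 y2].
have x1E : x1 = x - a *: grad_x f (x, y) by rewrite -[x1]/(x1, y1).1 -s1E.
have y1E : y1 = y + b *: grad_y f (x1, y) by rewrite x1E -[y1]/(x1, y1).2 -s1E.
have x2E : x2 = x1 - a *: grad_x f (x1, y1) by rewrite -[x2]/(x2, y2).1 -s2E.
have := altgda_one_step _ _ _ _ _ mux0 muy0 Lx0 Ly0 a0 b0 aLx bLy aLxy bLxy
  fc nash x1E y1E x2E.
by rewrite !enorm_sqr !div1r /=; lra.
Qed.

(** * The Lyapunov function dominates the squared distance *)

Lemma min_mulD_le {R : realType} (p q : R) {u v : R} :
  0 <= u -> 0 <= v -> Num.min p q * (u + v) <= p * u + q * v.
Proof.
move=> u0 v0; rewrite mulrDr; apply: lerD; apply: ler_wpM2r => //.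
  by rewrite ge_min lexx.
by rewrite ge_min lexx orbT.
Qed.

(** The subtracted gradient term is at most |x - xs|^2 / (2 a) + |y - ys|^2 / (2 b), which turns the
    coefficients of [Psi_alt] into those of [A_alt]. *)
Lemma Psi_alt_ge {R : realType} {dx dy : nat} {mux muy Lx Ly Lxy a b : R}
    {f : 'rV[R]_dx * 'rV[R]_dy -> R} {zs : 'rV[R]_dx * 'rV[R]_dy}
    (z0 : 'rV[R]_dx * 'rV[R]_dy) (k : nat) :
  0 <= mux -> mux <= Lx -> 0 < Lx -> 0 < a -> 0 < b ->
  2 * a * Lx <= 1 -> 4 * a * b * Lxy ^+ 2 <= 1 ->
  function_class mux muy Lx Ly Lxy f -> nash_equilibrium f zs ->
  A_alt mux muy a b * sqdist (altgda f a b z0 k) zs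
    <= Psi_alt mux muy Lx f a b zs z0 k.
Proof.
move=> mux0 muxLx Lx0 a0 b0 aLx abLxy fc nash.
rewrite /Psi_alt /V_alt /sqdist !enorm_sqr !div1r; cbv beta zeta.
move: (altgda f a b z0 k.+1).1 => x1.
case: (altgda f a b z0 k) => x y; case: zs nash => xs ys nash.
rewrite /A_alt /=.
apply: le_trans (min_mulD_le _ _ (dot_ge0 _) (dot_ge0 _)) _.
have xmin (v : 'rV[R]_dx) : f (xs, ys) <= f (v, ys) by have [] := nash v ys.
(* A zero gap forces the x-gradient to vanish at the equilibrium. *)
have := grad_sqr_le_gap xs xs mux0 Lx0 (function_class_x ys fc) xmin.
rewrite /= subrr mulr0 => /dot_le0 gs0.
have := dot_le_nearby (fc_lip_xx fc xs x y).
have := enorm_le_dot (fc_lip_xy fc xs ys y).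
rewrite gs0 subr0 /=.
move: (dot (grad_x f (xs, y)) _) (dot (grad_x f (x, y)) _) (dot_ge0 (grad_x f (x, y)))
  (dot_ge0 (x1 - xs)) => h g g0 X10.
move: (dot (x1 - xs) _) X10 (dot_ge0 (x - xs)) (dot_ge0 (y - ys)) => X1 X10.
move: (dot (x - xs) _) (dot (y - ys) _) => X Y X0 Y0 hY gh.
have ga : a * (1 - a * Lx) * g <= 2 * (a * h) + 2 * (a * Lx ^+ 2 * X).
  have aLx0 : 0 <= a * (1 - a * Lx) by apply: mulr_ge0; lra.
  apply: le_trans (ler_wpM2l aLx0 gh) _.
  have -> : 2 * (a * h) + 2 * (a * Lx ^+ 2 * X)
      = a * (2 * h + 2 * (Lx ^+ 2 * X)) by ring.
  by rewrite ler_wpM2r ?(le_trans g0 gh)// ler_piMr ?(ltW a0)// gerBl mulr_ge0// ltW.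
have ibhY : 2 * (a * h) <= b^-1 / 2 * Y.
  have ab0 : 0 <= 4 * a * b by rewrite !mulr_ge0// ltW.
  have {}hY : 4 * a * b * h <= Y.
    by apply: le_trans (ler_wpM2l ab0 hY) _; rewrite mulrA ler_piMl.
  rewrite -[leLHS](_ : b^-1 / 2 * (4 * a * b * h) = _); last first.
    by field; rewrite gt_eqF.
  by rewrite ler_wpM2l// divr_ge0// invr_ge0 ltW.
have iaX : 2 * (a * Lx ^+ 2 * X) <= a^-1 / 2 * X.
  have aLx2 : (2 * a * Lx) ^+ 2 * X <= X.
    by rewrite ler_piMl// exprn_ile1// !mulr_ge0// ltW.
  rewrite -[leLHS](_ : a^-1 / 2 * ((2 * a * Lx) ^+ 2 * X) = _); last first.
    by field; rewrite gt_eqF.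
  by rewrite ler_wpM2l// divr_ge0// invr_ge0 ltW.
have muxa : mux <= a^-1.
  apply: le_trans muxLx _; rewrite -(ler_pM2l a0) divff ?gt_eqF//.
  by have := mulr_gt0 a0 Lx0; lra.
have aX1 : 0 <= (a^-1 - mux) * X1 by rewrite mulr_ge0// subr_ge0.
rewrite (_ : 1 / (2 * a) = a^-1 / 2); last by field; rewrite gt_eqF.
rewrite (_ : 3 / (4 * b) = 3 / 4 * b^-1); last by field; rewrite gt_eqF.
move: a^-1 b^-1 ga ibhY iaX aX1 => ia ib *; lra.
Qed.

(** * Consequences of the choice of step sizes *)

(** The inverse has a uniform formula: at [Lxy = 0] the second term is 0 and the maximum is [L]. *)
Lemma step_sizeV {R : realType} {L mu Lxy : R} :
  0 < L -> 0 < mu -> 0 <= Lxy ->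
  (2 * step_size L mu Lxy)^-1 = Num.max L (Lxy * Num.sqrt L / Num.sqrt mu).
Proof.
move=> L0 mu0 Lxy0; rewrite /step_size div1r mulrA divff ?pnatr_eq0// mul1r.
have [->|Lxy_neq0] := eqVneq Lxy 0.
  by rewrite !mul0r invrK max_l// ltW.
have sL : 0 < Num.sqrt L by rewrite sqrtr_gt0.
have smu : 0 < Num.sqrt mu by rewrite sqrtr_gt0.
have Lxy_gt0 : 0 < Lxy by rewrite lt_def Lxy_neq0.
set q := Num.sqrt mu / _; have q0 : 0 < q by rewrite divr_gt0// mulr_gt0.
have -> : Lxy * Num.sqrt L / Num.sqrt mu = q^-1 by rewrite invf_div.
have [Lq|Lq] := leP L^-1 q.
  by rewrite invrK max_l// invf_ple.
by rewrite max_r// -[L]invrK lef_pV2 ?posrE ?invr_gt0// ltW.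
Qed.

Lemma step_size_bounds {R : realType} {L mu Lxy : R} (s := step_size L mu Lxy) :
  0 < L -> 0 < mu -> 0 <= Lxy ->
  [/\ 0 < s, 2 * s * L <= 1 & 4 * s ^+ 2 * L * Lxy ^+ 2 <= mu].
Proof.
move=> L0 mu0 Lxy0; have := step_sizeV L0 mu0 Lxy0; rewrite {}/s.
move: (step_size _ _ _) => s; set m := Num.max _ _ => sm.
have Lm : L <= m by rewrite le_max lexx.
have qm : Lxy * Num.sqrt L / Num.sqrt mu <= m by rewrite le_max lexx orbT.
have m0 : 0 < m := lt_le_trans L0 Lm.
have s2 : 2 * s = m^-1 by rewrite -sm invrK.
have s0 : 0 < 2 * s by rewrite s2 invr_gt0.
split; first by lra.
  by rewrite s2 mulrC ler_pdivrMr ?mul1r.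
have smu : 0 < Num.sqrt mu by rewrite sqrtr_gt0.
have : (2 * s * (Lxy * Num.sqrt L)) ^+ 2 <= Num.sqrt mu ^+ 2.
  rewrite ler_pXn2r ?nnegrE ?sqrtr_ge0//; last first.
    by rewrite mulr_ge0 ?(ltW s0)// mulr_ge0 ?sqrtr_ge0.
  by rewrite s2 mulrC ler_pdivrMr// [leRHS]mulrC -ler_pdivrMr.
by rewrite !exprMn (sqr_sqrtr (ltW mu0)) (sqr_sqrtr (ltW L0)) => h; lra.
Qed.

(** Multiplying the condition numbers by [mu] gives the sum of the two terms whose maximum is 1 / (2
    s), with s the step size. *)
Lemma step_size_rate {R : realType} {L mu mu' Lxy : R} :
  0 < L -> 0 < mu -> 0 < mu' -> 0 <= Lxy ->
  1 <= 2 * (L / mu + Lxy / Num.sqrt (mu * mu') * Num.sqrt (L / mu))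
         * (step_size L mu' Lxy * mu).
Proof.
move=> L0 mu0 mu'0 Lxy0; have := step_sizeV L0 mu'0 Lxy0.
have [+ _ _] := step_size_bounds L0 mu'0 Lxy0.
move: (step_size _ _ _) => s s0 sm.
rewrite [leRHS](_ : _ =
  (L + Lxy * Num.sqrt L / Num.sqrt mu') * (2 * s)); last first.
  rewrite !sqrtrM ?sqrtrV ?ltW//.
  have -> : mu = Num.sqrt mu ^+ 2 by rewrite sqr_sqrtr// ltW.
  rewrite sqrtr_sqr ger0_norm ?sqrtr_ge0//.
  by field; rewrite !gt_eqF ?sqrtr_gt0.
rewrite -ler_pdivrMr ?mulr_gt0// div1r sm ge_max lerDl lerDr.
by rewrite !mulr_ge0 ?invr_ge0 ?sqrtr_ge0// ltW.
Qed.

(** Multiplying the two bounds 4 s^2 L Lxy^2 <= mu shows that Lx Ly times the square of the left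
    side is at most mux muy <= Lx Ly. *)
Lemma step_size_product {R : realType} {Lx Ly mux muy Lxy : R} :
  0 < mux -> mux <= Lx -> 0 < muy -> muy <= Ly -> 0 <= Lxy ->
  4 * step_size Lx muy Lxy * step_size Ly mux Lxy * Lxy ^+ 2 <= 1.
Proof.
move=> mux0 muxLx muy0 muyLy Lxy0.
have Lx0 := lt_le_trans mux0 muxLx; have Ly0 := lt_le_trans muy0 muyLy.
have [a0 _ aL] := step_size_bounds Lx0 muy0 Lxy0.
have [b0 _ bL] := step_size_bounds Ly0 mux0 Lxy0.
move: (step_size Lx _ _) (step_size Ly _ _) a0 aL b0 bL => a b a0 aL b0 bL.
set t := 4 * a * b * Lxy ^+ 2.
have t0 : 0 <= t by rewrite !mulr_ge0// ?sqr_ge0// ltW.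
rewrite -(@expr_le1 _ 2)// -(ler_pM2l (mulr_gt0 Lx0 Ly0)) mulr1.
have -> : Lx * Ly * t ^+ 2
    = (4 * a ^+ 2 * Lx * Lxy ^+ 2) * (4 * b ^+ 2 * Ly * Lxy ^+ 2).
  by rewrite /t; ring.
apply: (@le_trans _ _ (Ly * Lx)); last by rewrite mulrC.
apply: ler_pM; rewrite ?(le_trans aL)// ?(le_trans bL)//.
  by rewrite !mulr_ge0 ?sqr_ge0// ltW.
by rewrite !mulr_ge0 ?sqr_ge0// ltW.
Qed.

(** The second argument of the minimum is always positive, since 3 / (4 b) >= 3/2 Ly. The first is
    max(Lx, Lxy sqrt(Lx) / sqrt(muy)) - mux, which alone decides the sign. *)
Lemma A_alt_ge0 {R : realType} {mux Lx muy Ly Lxy : R} :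
  0 < mux -> mux <= Lx -> 0 < muy -> muy <= Ly -> 0 <= Lxy ->
  let A := A_alt mux muy (step_size Lx muy Lxy) (step_size Ly mux Lxy) in
  0 <= A /\ (0 < A <-> (mux < Lx \/ Num.sqrt (muy * Lx) < Lxy)).
Proof.
move=> mux0 muxLx muy0 muyLy Lxy0.
have Lx0 := lt_le_trans mux0 muxLx; have Ly0 := lt_le_trans muy0 muyLy.
have [b0 bL _] := step_size_bounds Ly0 mux0 Lxy0.
rewrite /A_alt div1r step_sizeV//; move: (step_size Ly _ _) b0 bL => b b0 bL.
have By : 0 < 2 * (3 / (4 * b) - muy).
  have : Ly <= (2 * b)^-1 by rewrite -div1r ler_pdivlMr ?mulr_gt0// mulrC.
  rewrite (_ : 3 / (4 * b) = 3 / 2 * (2 * b)^-1); first by lra.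
  by field; rewrite gt_eqF.
rewrite le_min (ltW By) andbT lt_min By andbT subr_ge0 subr_gt0 le_max muxLx.
rewrite lt_max; split=> //.
have smuy : 0 < Num.sqrt muy by rewrite sqrtr_gt0.
have sLx : 0 < Num.sqrt Lx by rewrite sqrtr_gt0.
have cmp : (Lx < Lxy * Num.sqrt Lx / Num.sqrt muy) = (Num.sqrt (muy * Lx) < Lxy).
  have LxE : Lx = Num.sqrt Lx * Num.sqrt Lx by rewrite -expr2 sqr_sqrtr// ltW.
  rewrite ltr_pdivlMr// (sqrtrM _ (ltW muy0)) {1}LxE mulrAC ltr_pM2r//.
  by rewrite [in LHS]mulrC.
split=> [/orP[|]|[->//|]].
- by left.
- move=> h; have [|Lxmux] := ltP mux Lx; first by left.
  by right; rewrite -cmp; apply: le_lt_trans h.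
- by rewrite -cmp => /(le_lt_trans muxLx) ->; rewrite orbT.
Qed.

(** * From contraction to an iteration count *)

Lemma geometric_decay {R : realType} {theta : R} {P : nat -> R} :
  0 <= theta -> (forall k, (1 + theta) * P k.+1 <= P k) ->
  forall k, (1 + theta) ^+ k * P k <= P 0%N.
Proof.
move=> theta0 dec; elim=> [|k IH]; first by rewrite expr0 mul1r.
apply: le_trans IH; rewrite exprSr -mulrA ler_wpM2l// exprn_ge0//.
by rewrite addr_ge0.
Qed.

(** Follows from exp(-t/2) >= 1 - t/2 and (1 + t) (1 - t/2) = 1 + t (1 - t) / 2. *)
Lemma expR_half_le {R : realType} (t : R) : 0 <= t <= 1 -> expR (t / 2) <= 1 + t.
Proof.
move=> /andP[t0 t1]; have h := expR_ge1Dx (- (t / 2)).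
rewrite -(@ler_pM2r _ (expR (- (t / 2)))) ?expR_gt0// -expRD subrr expR0.
by apply: le_trans (_ : (1 + t) * (1 - t / 2) <= _); [nra|rewrite ler_pM2l; lra].
Qed.

Lemma geometric_complexity {R : realType} {theta kappa p q r : R} {K : nat} :
  0 < theta -> theta <= 1 -> 2 <= theta * kappa -> 0 <= p -> 0 < r ->
  kappa * ln (p / r) <= K%:R -> (1 + theta) ^+ K * q <= p -> q <= r.
Proof.
move=> theta0 theta1 tk p0 r0 hK hq.
have pow0 : 0 < (1 + theta) ^+ K by rewrite exprn_gt0// addr_gt0.
rewrite -(ler_pM2l pow0); apply: le_trans hq _.
(* The case p = 0 is separate because exp inverts [ln] only at positive arguments. *)
have [->|p_neq0] := eqVneq p 0; first by rewrite mulr_ge0// ltW.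
have pr0 : 0 < p / r by rewrite divr_gt0// lt_def p_neq0.
rewrite -ler_pdivrMr// -[p / r]lnK//.
have h : expR (theta / 2) ^+ K <= (1 + theta) ^+ K.
  apply: lerXn2r; rewrite ?nnegrE ?expR_ge0 ?addr_ge0 ?(ltW theta0)//.
  by rewrite expR_half_le// (ltW theta0).
apply: le_trans h; rewrite -expRM_natl ler_expR.
(* For a nonpositive logarithm any [K] works; otherwise it may scale 2 <= theta kappa. *)
have [l0|/ltW l0] := leP (ln (p / r)) 0.
  by apply: le_trans l0 _; rewrite mulr_ge0// divr_ge0// ltW.
have := ler_wpM2r l0 tk; have := ler_wpM2l (ltW theta0) hK.
by move: (ln _) K%:R => l k; lra.
Qed.

(** Up to nonpositive terms, theta Psi_{k+1} has coefficients theta / a <= mux / 2 and 2 theta / b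
    <= muy, which the dissipated terms cover. *)
Lemma altgda_contraction {R : realType} {dx dy : nat}
    {mux muy Lx Ly Lxy a b theta : R}
    {f : 'rV[R]_dx * 'rV[R]_dy -> R} {zs : 'rV[R]_dx * 'rV[R]_dy}
    (z0 : 'rV[R]_dx * 'rV[R]_dy) (k : nat)
    (Psi := Psi_alt mux muy Lx f a b zs z0) :
  0 <= mux -> 0 <= muy -> 0 < Lx -> 0 < Ly -> 0 < a -> 0 < b ->
  2 * a * Lx <= 1 -> 2 * b * Ly <= 1 ->
  4 * a ^+ 2 * Lx * Lxy ^+ 2 <= muy -> 4 * b ^+ 2 * Ly * Lxy ^+ 2 <= mux ->
  function_class mux muy Lx Ly Lxy f -> nash_equilibrium f zs ->
  0 <= theta -> 2 * theta <= a * mux -> 2 * theta <= b * muy ->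
  (1 + theta) * Psi k.+1 <= Psi k.
Proof.
move=> mux0 muy0 Lx0 Ly0 a0 b0 aLx bLy aLxy bLxy fc nash th0 tha thb.
have := altgda_dissipation z0 k mux0 muy0 Lx0 Ly0 a0 b0 aLx bLy aLxy bLxy fc nash.
rewrite -/Psi; move: (Psi k) => p0.
have : theta * Psi k.+1 <= mux / 2 * enorm ((altgda f a b z0 k.+1).1 - zs.1) ^+ 2
    + mux / 2 * enorm ((altgda f a b z0 k.+2).1 - zs.1) ^+ 2
    + muy * enorm ((altgda f a b z0 k.+1).2 - zs.2) ^+ 2.
  rewrite {}/Psi /Psi_alt /V_alt !div1r; cbv beta zeta.
  have : 0 <= theta * (a * (1 - a * Lx)
      * enorm (grad_x f (altgda f a b z0 k.+1)) ^+ 2).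
    have aLx1 : 0 <= 1 - a * Lx by have := mulr_gt0 a0 Lx0; lra.
    exact: mulr_ge0 th0 (mulr_ge0 (mulr_ge0 (ltW a0) aLx1) (sqr_ge0 _)).
  have tha' : theta * a^-1 <= mux / 2 by rewrite ler_pdivrMr//; lra.
  have thb' : theta * b^-1 <= muy / 2 by rewrite ler_pdivrMr//; lra.
  move: (a * _ * _) => ga ga0.
  move: (altgda f a b z0 k.+2) (altgda f a b z0 k.+1) ga0 => z2 z1 ga0 /=.
  move: (enorm _ ^+ 2) (sqr_ge0 (enorm (z1.1 - zs.1))) => X1 X10.
  move: (enorm _ ^+ 2) (sqr_ge0 (enorm (z1.2 - zs.2))) => Y Y0.
  move: (enorm _ ^+ 2) (sqr_ge0 (enorm (z2.1 - zs.1))) => X2 X20.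
  have := ler_wpM2r X10 tha'; have := ler_wpM2r X20 tha'; have := ler_wpM2r Y0 thb'.
  have := mulr_ge0 (mulr_ge0 th0 mux0) X10; have := mulr_ge0 (mulr_ge0 th0 mux0) X20.
  have := mulr_ge0 (mulr_ge0 th0 muy0) Y0.
  move: a^-1 b^-1 tha' thb' => ia ib; lra.
move: (Psi k.+1) (altgda f a b z0 k.+2) (altgda f a b z0 k.+1) => p1 z2 z1.
have := mulr_ge0 mux0 (sqr_ge0 (enorm (z2.1 - zs.1))).
have := mulr_ge0 muy0 (sqr_ge0 (enorm (z1.2 - zs.2))).
move: (enorm (z1.1 - zs.1) ^+ 2) (enorm (z1.2 - zs.2) ^+ 2).
by move: (enorm (z2.1 - zs.1) ^+ 2) => *; lra.
Qed.

(* The constant C of the O(.) is absolute: it is chosen before the dimensions,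
   the parameters, f, the initial point and the accuracy.  The paper's claim
   0 < A fails exactly when mux = Lx and Lxy <= sqrt (muy * Lx); then A = 0 and
   the stated bound is infinite, hence the guard 0 < A on the last conjunct. *)
Theorem corollary4p2 (R : realType) :
  exists2 C : R, 0 < C &
  forall (dx dy : nat) (mux Lx muy Ly Lxy : R),
  0 < mux -> mux <= Lx -> 0 < muy -> muy <= Ly -> 0 <= Lxy ->
  forall f : 'rV[R]_dx * 'rV[R]_dy -> R,
  function_class mux muy Lx Ly Lxy f ->
  forall zs : 'rV[R]_dx * 'rV[R]_dy, nash_equilibrium f zs ->
  let alpha := step_size Lx muy Lxy in
  let beta := step_size Ly mux Lxy in
  let kx := Lx / mux in
  let ky := Ly / muy in
  let kxy := Lxy / Num.sqrt (mux * muy) in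
  let A := A_alt mux muy alpha beta in
  (0 < A <-> (mux < Lx \/ Num.sqrt (muy * Lx) < Lxy)) /\
  forall z0 : 'rV[R]_dx * 'rV[R]_dy,
  let z := altgda f alpha beta z0 in
  let Psi := Psi_alt mux muy Lx f alpha beta zs z0 in
  linearly_converges z zs /\
  (0 < A ->
   forall (eps : R) (K : nat), 0 < eps ->
   C * ((kx + ky + kxy * (Num.sqrt kx + Num.sqrt ky))
        * ln (Psi 0%N / (A * eps))) <= K%:R ->
   sqdist (z K) zs <= eps).
Proof.
(* By [step_size_rate], kappa times alpha mux or beta muy is at least 1/2, so theta kappa >= 1/4;
   [geometric_complexity] asks for theta (C kappa) >= 2. *)
exists 8; first by [].
move=> dx dy mux Lx muy Ly Lxy mux0 muxLx muy0 muyLy Lxy0 f fc zs nash.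
move=> alpha beta kx ky kxy A.
have [A0 Aiff] := A_alt_ge0 mux0 muxLx muy0 muyLy Lxy0; split=> // z0 z Psi.
have Lx0 := lt_le_trans mux0 muxLx; have Ly0 := lt_le_trans muy0 muyLy.
have [a0 aLx aLxy] := step_size_bounds Lx0 muy0 Lxy0.
have [b0 bLy bLxy] := step_size_bounds Ly0 mux0 Lxy0.
have ab_Lxy := step_size_product mux0 muxLx muy0 muyLy Lxy0.
have rate_x := step_size_rate Lx0 mux0 muy0 Lxy0.
have rate_y := step_size_rate Ly0 muy0 mux0 Lxy0.
rewrite -/alpha -/kx -/kxy in a0 aLx aLxy A0 ab_Lxy rate_x.
rewrite [muy * mux]mulrC -/beta -/ky -/kxy in b0 bLy bLxy ab_Lxy rate_y.
rewrite -/alpha -/beta -/A in A0; clear Aiff; clearbody alpha beta.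
have Psi_ge k : A * sqdist (z k) zs <= Psi k.
  by apply: Psi_alt_ge fc nash => //; exact: ltW.
have sq0 k : 0 <= sqdist (z k) zs by rewrite addr_ge0// sqr_ge0.
have Psi0 k : 0 <= Psi k by apply: le_trans (Psi_ge k); rewrite mulr_ge0.
pose theta := Num.min (alpha * mux) (beta * muy) / 2.
have th_gt0 : 0 < theta.
  by rewrite divr_gt0// lt_min (mulr_gt0 a0 mux0) (mulr_gt0 b0 muy0).
have tha : 2 * theta <= alpha * mux by rewrite mulrC divfK// ge_min lexx.
have thb : 2 * theta <= beta * muy by rewrite mulrC divfK// ge_min lexx orbT.
have th1 : theta <= 1.
  by have := ler_wpM2l (ltW a0) muxLx; lra.
have dec := geometric_decay (ltW th_gt0) (fun k => altgda_contraction z0 k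
  (ltW mux0) (ltW muy0) Lx0 Ly0 a0 b0 aLx bLy aLxy bLxy fc nash (ltW th_gt0) tha thb).
rewrite -/Psi in dec.
split.
  (* As A may be 0, the distance is bounded by the dissipation instead: m |z_{k+1} - z*|^2 <=
     Psi_k. *)
  pose m := Num.min (mux / 2) muy; pose rho := (1 + theta)^-1.
  have m0 : 0 < m by rewrite lt_min divr_gt0.
  have th1_gt0 : 0 < 1 + theta by rewrite addr_gt0.
  have rho0 : 0 <= rho by rewrite invr_ge0 ltW.
  (* The bound lags by one index: the first summand handles k = 0, and the factor 1 + theta
     compensates the shift. *)
  exists (sqdist (z 0%N) zs + (1 + theta) * (Psi 0%N / m)), rho; split.
    by rewrite rho0 invf_lt1// ltrDl.
  case=> [|k].
    by rewrite expr0 mulr1 lerDl mulr_ge0 ?(ltW th1_gt0)// divr_ge0// ltW.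
  rewrite mulrDl; apply: ler_wpDl; first by rewrite mulr_ge0// exprn_ge0.
  rewrite exprS mulrACA divff ?gt_eqF// mul1r mulrAC ler_pdivlMr//.
  apply: (@le_trans _ _ (Psi k)).
    have := altgda_dissipation z0 k (ltW mux0) (ltW muy0) Lx0 Ly0 a0 b0
      aLx bLy aLxy bLxy fc nash.
    rewrite -/Psi -/z [_ * m]mulrC.
    move: (Psi k.+1) (Psi0 k.+1) (Psi k) (z k.+2) (z k.+1) => p1 p1_ge0 p0 z2 z1.
    have := min_mulD_le (mux / 2) muy (sqr_ge0 (enorm (z1.1 - zs.1)))
      (sqr_ge0 (enorm (z1.2 - zs.2))).
    rewrite -/(sqdist z1 zs) -/m.
    have := mulr_ge0 (ltW mux0) (sqr_ge0 (enorm (z2.1 - zs.1))).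
    have := mulr_ge0 (ltW muy0) (sqr_ge0 (enorm (z1.2 - zs.2))).
    move: (m * _) (enorm (z1.1 - zs.1) ^+ 2) (enorm (z1.2 - zs.2) ^+ 2).
    by move: (enorm (z2.1 - zs.1) ^+ 2) => *; lra.
  by rewrite exprVn ler_pdivlMr ?exprn_gt0// mulrC.
set kappa := kx + ky + _.
have kappa_ge : 2 <= theta * (8 * kappa).
  have kxy0 : 0 <= kxy by rewrite divr_ge0// sqrtr_ge0.
  have kx0 : 0 < kx by rewrite divr_gt0.
  have ky0 : 0 < ky by rewrite divr_gt0.
  rewrite {}/kappa; clearbody kx ky kxy.
  have kx_le : kx + kxy * Num.sqrt kx <= kx + ky + kxy * (Num.sqrt kx + Num.sqrt ky).
    have := mulr_ge0 kxy0 (sqrtr_ge0 ky).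
    by lra.
  have ky_le : ky + kxy * Num.sqrt ky <= kx + ky + kxy * (Num.sqrt kx + Num.sqrt ky).
    have := mulr_ge0 kxy0 (sqrtr_ge0 kx).
    by lra.
  have {}kx_le := ler_wpM2r (ltW (mulr_gt0 a0 mux0)) kx_le.
  have {}ky_le := ler_wpM2r (ltW (mulr_gt0 b0 muy0)) ky_le.
  rewrite /theta; have [_|_] := leP (alpha * mux) (beta * muy); lra.
move=> A_gt0 eps K eps0 hK; rewrite -(ler_pM2l A_gt0).
apply: le_trans (Psi_ge K) _.
apply: (geometric_complexity th_gt0 th1 kappa_ge (Psi0 0%N) (mulr_gt0 A_gt0 eps0)
  _ (dec K)).
by rewrite -mulrA.
Qed.
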